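(* Let $f\geq 3$ be a fixed integer. For a prime $p$ and a positive integer $n$, let $\Psi_{n,f}^p$ denote the number of isomorphism classes of groups of order $p^n$ and coexponent $f$. Then for $p>f+1$ and $n\geq 3f$ the number $\Psi_{n,f}^p$ depends only on $p$; that is, for every prime $p>f+1$ and all integers $n,n'\geq 3f$ one has $\Psi_{n,f}^p=\Psi_{n',f}^p$.
   Context: For a finite $p$-group $P$ of order $p^n$ and exponent $p^e$, the coexponent of $P$ is $f(P)=n-e$. *)

(* Defs.v *)
From mathcomp Require Import all_boot all_fingroup all_solvable.

Set Implicit Arguments.
Unset Strict Implicit.
Unset Printing Implicit Defensive.

Local Open Scope group_scope.

(* If #|P| = p ^ n and exponent P = p ^ e, this is n - e; see coexponentE.
   The truncated subtraction is harmless since exponent P divides #|P|. *)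
Definition coexponent (gT : finGroupType) (p : nat) (P : {set gT}) : nat :=
  logn p #|P| - logn p (exponent P).

Lemma coexponentE (gT : finGroupType) (p n e : nat) (P : {group gT}) :
  prime p -> #|P| = (p ^ n)%N -> exponent P = (p ^ e)%N ->
  e <= n /\ coexponent p P = (n - e)%N.
Proof.
move=> pr_p oP eP; split; last by rewrite /coexponent oP eP !pfactorK.
by have := exponent_dvdn P; rewrite oP eP dvdn_Pexp2l ?prime_gt1.
Qed.

(* By Cayley's theorem, every group of order m is isomorphic to a subgroup of
   the symmetric group on 'I_m, so these groups meet every isomorphism class
   of groups of order p ^ n and coexponent f; see Psi_spec. *)
Definition groups_of_coexponent (p n f : nat) :
    {set {group {perm 'I_(p ^ n)}}} :=
  [set P : {group {perm 'I_(p ^ n)}}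
     | (#|P| == p ^ n)%N && (coexponent p P == f)].

Definition Psi (p n f : nat) : nat :=
  #|equivalence_partition (fun G H : {group {perm 'I_(p ^ n)}} => G \isog H)
                          (groups_of_coexponent p n f)|.

Lemma Cayley_ord (gT : finGroupType) (G : {group gT}) (m : nat) :
  #|G| = m -> exists H : {group {perm 'I_m}}, G \isog H.
Proof.
move=> oG; have cS : #|{: subg_of G}| = m.
  by rewrite -cardsT -oG (card_isog (isog_subg G)).
pose r (x : subg_of G) : 'I_m := cast_ord cS (enum_rank x).
pose v (i : 'I_m) : subg_of G := enum_val (cast_ord (esym cS) i).
have rK : cancel r v by move=> x; rewrite /r /v cast_ordK enum_rankK.
have vK : cancel v r by move=> i; rewrite /r /v enum_valK cast_ordKV.
have phi_inj x : injective (fun i => r (v i * x)).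
  by move=> i j /(can_inj rK)/mulIg/(can_inj vK).
pose phi x : {perm 'I_m} := perm (phi_inj x).
have phiM : {in [set: subg_of G] &, {morph phi : x y / x * y}}.
  by move=> x y _ _; apply/permP=> i; rewrite permM !permE rK mulgA.
exists (Morphism phiM @* [set: subg_of G])%G.
apply: isog_trans (isog_subg G) _; apply: sub_isog => //.
apply/injmP=> x y _ _ /= /permP/(_ (r 1)).
by rewrite !permE rK !mul1g => /(can_inj rK).
Qed.

(* Psi p n f is the number of isomorphism classes of arbitrary finite groups of
   order p ^ n and coexponent f: there is an irredundant system of Psi p n f
   representatives. *)
Lemma Psi_spec (p n f : nat) :
  exists P : 'I_(Psi p n f) -> {group {perm 'I_(p ^ n)}},
  [/\ forall i, #|P i| = (p ^ n)%N /\ coexponent p (P i) = f,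
      forall i j, P i \isog P j -> i = j
    & forall (gT : finGroupType) (G : {group gT}),
        #|G| = (p ^ n)%N -> coexponent p G = f -> exists i, G \isog P i].
Proof.
pose D := groups_of_coexponent p n f.
pose R := fun G H : {group {perm 'I_(p ^ n)}} => G \isog H.
have eqR : {in D & &, equivalence_rel R}.
  move=> x y z _ _ _; split=> [|xy]; first exact: isog_refl.
  exact: (isog_transl _ xy).
have partP := equivalence_partitionP eqR.
have trP := transversalP partP.
set Q := equivalence_partition R D in partP trP.
set X := transversal Q D in trP.
have oX : #|X| = Psi p n f := card_transversal trP.
have XD := subsetP (transversal_sub trP).
have QD : cover Q = D by apply: cover_partition.
exists (fun i => enum_val (cast_ord (esym oX) i)); split.
- by move=> i; have := XD _ (enum_valP (cast_ord (esym oX) i));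
    rewrite inE => /andP[/eqP-> /eqP->].
- move=> i j iso_ij; apply: (@cast_ord_inj _ _ (esym oX)); apply: enum_val_inj.
  set x := enum_val _ in iso_ij *; set y := enum_val _ in iso_ij *.
  have [Xx Xy] : x \in X /\ y \in X by split; apply: enum_valP.
  apply: (pblock_inj trP) => //; apply/eqP.
  rewrite eq_pblock ?(partition_trivIset partP) ?QD ?XD //.
  by rewrite (pblock_equivalence_partition eqR) ?XD.
move=> gT G oG cG; have [H isoGH] := Cayley_ord oG.
have DH : H \in D.
  move: cG; rewrite inE /coexponent -(card_isog isoGH) -(exponent_isog isoGH).
  by rewrite oG => ->; rewrite !eqxx.
have QH : pblock Q H \in Q by rewrite pblock_mem ?QD.
pose x := transversal_repr H X (pblock Q H).
have Xx : x \in X by apply: (repr_mem_transversal trP).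
have : x \in pblock Q H by apply: (repr_mem_pblock trP).
rewrite (pblock_equivalence_partition eqR DH (XD _ Xx)) => isoHx.
exists (cast_ord oX (enum_rank_in Xx x)).
by rewrite cast_ordK enum_rankK_in //; apply: isog_trans isoGH isoHx.
Qed.

(* Main.v *)
Require Import Defs.
From mathcomp Require Import all_boot all_fingroup all_solvable all_algebra.
From mathcomp Require Import zify ring.

(** Write [q = p ^ f], [n = m + 2 f], and let [x] be an element of maximal order
    [p ^ (m + f)] in [P]; the hypothesis on [n] says that [m >= f]. By induction
    on [f], through a maximal subgroup containing [x], the power [x ^ q] is
    central, [P] has class at most [f + 1 < p], and [g |-> g ^ q] is a morphism
    from [P] onto [<x ^ q>]. With [K] its kernel, of order [p ^ (2 f)], this gives
    [P = K <x>] and [K :&: <x> = <x ^ (p ^ m)>], so [P] is determined by [m], [K],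
    the action of [x] on [K], and the element [x ^ (p ^ m)] of [K]. The last three
    data occur for [m] if and only if they occur for any other [m' >= f]: adjoin
    to [P] a central [p ^ m']-th root [c] of the central element
    [x ^ (p ^ m) * x ^ (- p ^ m')] and take the subgroup generated by [K] and
    [x c]. *)

Set Implicit Arguments.
Unset Strict Implicit.
Unset Printing Implicit Defensive.

Local Open Scope group_scope.

(** * Automorphisms of [p]-power exponent on cyclic [p]-groups, for odd [p] *)

(** With i = b p + 1 one has i^t = 1 + t b p modulo p^2, and the linear terms add up to b p times p
    (p - 1) / 2, a multiple of p^2 because [p] is odd. The sum is the cofactor of i - 1 in i^p - 1,
    so [p] divides that cofactor exactly once. *)
Lemma sum_expn_mod_sqr p i :
  1 < p -> odd p -> i = 1 %[mod p] -> \sum_(t < p) i ^ t = p %[mod p ^ 2].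
Proof.
move=> p_gt1 odd_p i1; have [i0|i_gt0] := posnP i.
  by move: i1; rewrite i0 mod0n modn_small.
have /dvdnP[b Db] : p %| i - 1 by rewrite -eqn_mod_dvd //; apply/eqP.
have {Db} Di : i = (b * p + 1)%N by rewrite -Db subnK.
have powE t : i ^ t = 1 + t * (b * p) %[mod p ^ 2].
  elim: t => [|t IHt]; first by rewrite mul0n addn0.
  rewrite expnS -modnMmr IHt modnMmr Di.
  rewrite (_ : (_ * _)%N = (t * b * b) * p ^ 2 + (1 + t.+1 * (b * p)))%N; last first.
    by rewrite expnS expn1; ring.
  by rewrite modnMDl.
rewrite -modn_summ; under eq_bigr do rewrite powE; rewrite modn_summ.
rewrite big_split /= sum1_card card_ord -big_distrl /= -(big_mkord xpredT id).
rewrite bin2_sum bin2odd // (_ : (_ + _)%N = p./2 * 0 + p.-1./2 * b * p ^ 2 + p)%N.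
  by rewrite muln0 modnMDl.
by rewrite expnS expn1; ring.
Qed.

(** Conjugation by [u] raises [z] to some power i with i^p = 1 modulo [#[z]]. By Fermat i = 1 modulo
    [p], so i^p - 1 = (i - 1) S p with S prime to [p]. Hence [#[z]] divides (i - 1) p, and [u] fixes
    [z ^+ p]. *)
Lemma conj_pth_power_fix (gT : finGroupType) p (z u : gT) :
    prime p -> odd p -> p.-elt z -> z ^ u \in <[z]> -> z ^ (u ^+ p) = z ->
  (z ^+ p) ^ u = z ^+ p.
Proof.
move=> p_pr odd_p /p_natP[k oz] /cycleP[i Dzu] zup.
have zuE j : z ^ (u ^+ j) = z ^+ (i ^ j).
  by elim: j => [|j IHj]; rewrite ?conjg1 // expgSr conjgM IHj conjXg Dzu -expgM expnS mulnC.
have [z1 | ntz] := eqVneq z 1; first by rewrite z1 !expg1n conj1g.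
have k_gt0 : 0 < k.
  by case: k oz ntz => // /eqP; rewrite order_eq1 => ->.
have ip1 : i ^ p == 1 %[mod p ^ k] by rewrite -oz -eq_expg_mod_order -zuE zup.
have i1 : i = 1 %[mod p].
  rewrite -(fermat_little i p_pr); apply/eqP.
  by rewrite -(modn_dvdm (i ^ p) (dvdn_exp2l p k_gt0)) (eqP ip1) modn_dvdm ?dvdn_exp2l.
have i_gt0: 0 < i.
  by case: (i) i1 => //; rewrite mod0n modn_small ?prime_gt1.
have [S oS DS] : exists2 S, coprime (p ^ k) S & \sum_(t < p) i ^ t = (S * p)%N.
  have Sp := sum_expn_mod_sqr (prime_gt1 p_pr) odd_p i1.
  have: p %| \sum_(t < p) i ^ t.
    rewrite /dvdn -(@modn_dvdm (p ^ 2)) ?dvdn_exp // Sp modn_dvdm ?dvdn_exp //.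
    by rewrite modnn.
  case/dvdnP=> S DS; exists S => //; rewrite coprimeXl // prime_coprime //.
  apply/negP=> /dvdnP[S' DS']; move/eqP: Sp.
  rewrite DS DS' -mulnA mulnn modnMl modn_small -?mulnn ?ltn_Pmulr ?prime_gt0 ?prime_gt1 //.
  by case: (p) (prime_gt0 p_pr).
have: p ^ k %| (i ^ p).-1 by rewrite -subn1 -eqn_mod_dvd ?expn_gt0 ?i_gt0.
rewrite predn_exp DS mulnCA Gauss_dvdr // => pk_i1.
rewrite conjXg Dzu -expgM; apply/eqP; rewrite eq_expg_mod_order oz.
rewrite eqn_mod_dvd ?leq_pmull //.
by rewrite -[X in _ - X]mul1n -mulnBl subn1.
Qed.

(** * Commutators in the lower central series *)

(** Three subgroups lemma modulo ['L_j.+3(G)], where bracketing ['L_j.+1(G)] twice with [G] is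
    trivial. *)
Lemma lcn_der1_comm (gT : finGroupType) (G : {group gT}) j :
  [~: 'L_j.+1(G), G^`(1)] \subset 'L_j.+3(G).
Proof.
set N := 'L_j.+3(G); have nNG : G \subset 'N(N) := lcn_norm _ G.
have nNL : 'L_j.+1(G) \subset 'N(N) := subset_trans (lcn_sub _ _) nNG.
have LGG : [~: 'L_j.+1(G) / N, G / N, G / N] = 1.
  rewrite -!quotientR ?(subset_trans (lcn_sub j.+2 G)) //.
  exact: trivg_quotient.
rewrite commGC -quotient_cents2 ?(subset_trans (der_sub 1 G)) //.
rewrite (sameP commG1P eqP) quotientR //.
by apply/eqP/three_subgroup; rewrite // [[~: _ / _, 'L__(_) / _]]commGC.
Qed.

(** Modulo ['L_3(G)] the derived subgroup is central, so <g>G' becomes abelian; this is the base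
    case. The result lets <g>G' have smaller class than [G]. *)
Lemma lcn_cycle_der1 (gT : finGroupType) (G : {group gT}) g j :
  g \in G -> 'L_j.+2(<[g]> <*> G^`(1)) \subset 'L_j.+3(G).
Proof.
move=> Gg; set H := <[g]> <*> G^`(1).
have sHG : H \subset G by rewrite join_subG cycle_subG Gg der_sub.
elim: j => [|j IHj]; last exact: commgSS IHj sHG.
have nNG : G \subset 'N('L_3(G)) := lcn_norm _ G.
apply: der1_min; first exact: subset_trans sHG nNG.
have nNg : <[g]> \subset 'N('L_3(G)) by rewrite (subset_trans _ nNG) ?cycle_subG.
have nNG' : G^`(1) \subset 'N('L_3(G)) by rewrite (subset_trans (der_sub 1 G)).
have cG'G : G^`(1) / 'L_3(G) \subset 'C(G / 'L_3(G)).
  by rewrite quotient_cents2 // lcnSn.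
rewrite quotientY // abelianY quotient_abelian ?cycle_abelian //=.
rewrite /abelian !(subset_trans cG'G) ?centS ?quotientS ?der_sub //.
by rewrite cycle_subG.
Qed.

(** * Graphs of power maps on the lower central factors *)

(** The graph of the [a]-th power map on K/N, pulled back to pairs of elements. A relation is used
    because this map need not lift to an endomorphism of [G]. *)
Definition power_graph (gT : finGroupType) (G K N : {set gT}) a : {set gT * gT} :=
  [set u in setX K G | coset N u.2 == coset N u.1 ^+ a].

Lemma power_graph_group_set (gT : finGroupType) (G K N : {group gT}) a :
    N <| G -> K \subset G -> abelian (K / N) ->
  group_set (power_graph G K N a).
Proof.
move=> /andP[_ nNG] sKG abK; apply/group_setP; split=> [|[s t] [s' t']].
  by rewrite !inE /= (group1 K) (group1 G) morph1 expg1n; apply/eqP.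
rewrite !inE /= => /andP[/andP[Ks Gt] /eqP/= e] /andP[/andP[Ks' Gt'] /eqP/= e'].
have nN := subsetP nNG; have nNK s1 (Ks1 : s1 \in K) := nN s1 (subsetP sKG s1 Ks1).
rewrite (groupM Ks Ks') (groupM Gt Gt') /= coset_morphM ?nN // coset_morphM ?nNK //.
rewrite e e' expgMn //; apply: (centsP abK); exact: mem_quotient.
Qed.

Lemma power_graph_dec (gT : finGroupType) (G K N : {group gT}) a u :
    N <| G -> K \subset G -> u \in power_graph G K N a ->
  [/\ u.1 \in K, u.2 \in G & exists2 z, z \in N & u.2 = u.1 ^+ a * z].
Proof.
move=> /andP[_ nNG] sKG; rewrite !inE => /andP[/andP[Ku Gu] /eqP e].
have Gu1 := subsetP sKG _ Ku.
split=> //; exists ((u.1 ^+ a)^-1 * u.2); last by rewrite mulKVg.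
apply: coset_idr; first by rewrite (subsetP nNG) // groupM ?groupV ?groupX.
by rewrite morphM ?morphV ?morphX ?(subsetP nNG) ?groupV ?groupX //= e mulVg.
Qed.

(** Modulo ['L_j.+3(G)], the commutator is bilinear on ['L_j.+1(G)] and [G], and depends only on
    their classes modulo ['L_j.+2(G)] and G'. Raising its entries to the powers i^(j+1) and i
    therefore raises it to the power i^(j+2). *)
Lemma lcn_power_graph (gT : finGroupType) (G : {group gT}) i j
    (T : {group gT * gT}) :
    T \subset power_graph G G G^`(1) i ->
  'L_j.+1(T) \subset power_graph G 'L_j.+1(G) 'L_j.+2(G) (i ^ j.+1).
Proof.
move=> sT; elim: j => [|j IHj]; first by rewrite expn1.
have gS : group_set (power_graph G 'L_j.+2(G) 'L_j.+3(G) (i ^ j.+2)).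
  apply: power_graph_group_set; rewrite ?lcn_normal ?lcn_sub //.
  by apply: abelianS (center_abelian _); apply: lcn_central.
rewrite lcnSn -[power_graph _ _ _ _]/(gval (Group gS)) gen_subG.
apply/subsetP=> _ /imset2P[u v Lu Tv ->].
have [u1 u2 [z Lz Du2]] :=
  power_graph_dec (lcn_normal _ _) (lcn_sub _ _) (subsetP IHj u Lu).
have [v1 v2 [w G'w Dv2]] :=
  power_graph_dec (der_normal _ _) (subxx _) (subsetP sT v Tv).
set N := 'L_j.+3(G).
have nNG : G \subset 'N(N) := lcn_norm _ G.
have LG := subsetP (lcn_sub j.+1 G); have LG2 := subsetP (lcn_sub j.+2 G).
have G'G := subsetP (der_sub 1 G); have nN := subsetP nNG.
rewrite !inE /= mem_commg //= groupR //= -/N.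
have cLG : 'L_j.+2(G) / N \subset 'C(G / N).
  by rewrite quotient_cents2 ?(subset_trans (lcn_sub _ _)) // lcnSn.
have cG'L : 'L_j.+1(G) / N \subset 'C(G^`(1) / N).
  by rewrite quotient_cents2 ?lcn_der1_comm ?(subset_trans (lcn_sub _ _)) // (subset_trans (der_sub 1 _)).
have nu : u.1 \in 'N(N) by exact: nN (LG _ u1).
have nv : v.1 \in 'N(N) by exact: nN.
have nz : z \in 'N(N) by exact: nN (LG2 _ Lz).
have nw : w \in 'N(N) by exact: nN (G'G _ G'w).
rewrite Du2 Dv2 !morphR ?groupM ?groupX // !morphM ?groupX // !morphX //=.
set cu := coset N u.1; set cv := coset N v.1.
set cz := coset N z; set cw := coset N w.
have cent_z y : y \in G / N -> commute cz y by move=> Gy; apply: (centsP cLG); rewrite ?mem_quotient.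
have Gcu : cu \in G / N by rewrite mem_quotient ?LG.
have Gcv : cv \in G / N by rewrite mem_quotient.
have Gcw : cw \in G / N by rewrite mem_quotient ?G'G.
have ccR : forall y, y \in G / N -> commute y [~ cu, cv].
  move=> y Gy; apply/commute_sym; rewrite -morphR //.
  by apply: (centsP cLG); rewrite ?mem_quotient ?mem_commg.
have com_w : commute (cu ^+ (i ^ j.+1)) cw.
  by apply/commute_sym/commuteX/commute_sym/(centsP cG'L); rewrite mem_quotient.
set a := cu ^+ _; set b := cv ^+ i.
have Dc : [~ a, b] = [~ cu, cv] ^+ (i ^ j.+2).
  rewrite commXXg; [by rewrite mulnC -expnS | exact: ccR | exact: ccR].
have Ga : a \in G / N by rewrite groupX.
have Gb : b \in G / N by rewrite groupX.
have fixJ (x y : coset_of N) : commute x y -> x ^ y = x by move/commgP/conjg_fixP.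
(* Here [cz] is central and [cw] commutes with both [a] and [[~ a, b]], so the commutator of
   [a * cz] with [b * cw] reduces to [[~ a, b]]. *)
rewrite -Dc; apply/eqP; rewrite commgEl conjgM.
rewrite (conjMg a cz b) (fixJ cz b (cent_z b Gb)) (conjMg _ cz cw) (fixJ cz cw (cent_z cw Gcw)).
rewrite -(mulKVg a (a ^ b)) -commgEl (conjMg a) (fixJ a cw) //.
rewrite (fixJ [~ a, b] cw); last by rewrite Dc; apply/commute_sym/commuteX/ccR.
by rewrite -(mulgA a) -(cent_z [~ a, b] (groupR Ga Gb)) (mulgA a) mulKg.
Qed.

(** * Multiplicativity of a central power map in class less than [p] *)

(** The nonzero polynomial X^c - X has degree c < p, so it cannot vanish on all of the field with
    [p] elements. *)
Lemma exists_expn_neq_mod p c :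
  prime p -> 1 < c -> c < p -> exists i, i ^ c != i %[mod p].
Proof.
move=> p_pr c_gt1 ltcp.
case: (pickP (fun i : 'I_p => i ^ c != i %[mod p])) => [i|all_eq]; first by exists i.
pose P : {poly 'F_p} := ('X^c - 'X)%R.
have sP : size P = c.+1 by rewrite /P size_polyDl ?size_polyXn // size_polyN size_polyX.
have nzP : (P != 0)%R by rewrite -size_poly_eq0 sP.
have /(max_poly_roots nzP) : all (root P) (enum 'F_p).
  apply/allP=> x _; rewrite /root !hornerE -(natr_Zp x) -GRing.natrX.
  have ltxp : x < p by rewrite -[X in _ < X](Fp_cast p_pr) ltn_ord.
  rewrite GRing.subr_eq0 -[((_ ^ _)%:R)%R](Fp_nat_mod p_pr) -[(x%:R)%R](Fp_nat_mod p_pr).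
  by have /negbFE/eqP-> := all_eq (Ordinal ltxp).
rewrite enum_uniq -cardE card_Fp // sP => /(_ isT).
by rewrite ltnS leqNgt ltcp.
Qed.

(* Induction on the class c of G. For g in G the subgroup <g>G' has smaller
   class, so the q-th power map kills G' and factors through G / G'; write D g h
   for its defect of multiplicativity. The induction hypothesis for T / L_c(T),
   where T is the set of pairs (s, t) with t = s ^ i modulo G', yields
   D (g ^ i) (h ^ i) = D g h ^ (i ^ c), whereas the factorization yields
   D (g ^ i) (h ^ i) = D g h ^ i. Some i satisfies i ^ c <> i modulo p. *)
Lemma expg_morph (gT : finGroupType) (G : {group gT}) p q :
    prime p -> p.-group G -> nil_class G < p ->
    {in G, forall g, g ^+ q \in 'Z(G)} ->
  {in G &, forall g h, (g * h) ^+ q = g ^+ q * h ^+ q}.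
Proof.
move=> p_pr pG; move: (leqnn (nil_class G)).
move: {-1}(nil_class G) => c; elim: c gT G pG => [|c IHc] gT G pG cG ltcp ZGq g h Gg Gh.
  have abG : abelian G by rewrite -nil_class1 (leq_trans cG).
  by rewrite expgMn //; apply: (centsP abG).
have [c0 | c_gt0] := posnP c.
  have abG : abelian G by rewrite -nil_class1 -c0.
  by rewrite expgMn //; apply: (centsP abG).
have nilG := pgroup_nil pG.
have cGq x y : x \in G -> y \in G -> commute (x ^+ q) y.
  by move=> Gx Gy; have /centerP[_ cx] := ZGq x Gx; apply: cx.
have IHH x : x \in G ->
    {in <[x]> <*> G^`(1) &, forall y z, (y * z) ^+ q = y ^+ q * z ^+ q}.
  move=> Gx; set H := _ <*> _.
  have sHG : H \subset G by rewrite join_subG cycle_subG Gx der_sub.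
  apply: IHc (pgroupS sHG pG) _ (ltnW ltcp) _ => [|y Hy].
    apply/lcn_nil_classP; first exact: nilpotentS nilG.
    apply/trivgP; rewrite -(lcn_nil_classP _ nilG cG) -(prednK c_gt0).
    exact: lcn_cycle_der1.
  by apply/centerP; split=> [|z Hz]; [apply: groupX | apply: cGq; apply: (subsetP sHG)].
have powG' t : t \in G^`(1) -> t ^+ q = 1.
  have gS : group_set [set t in G^`(1) | t ^+ q == 1].
    apply/group_setP; split=> [|x y]; first by rewrite inE group1 expg1n /=.
    rewrite !inE => /andP[G'x /eqP xq] /andP[G'y /eqP yq].
    rewrite groupM //= (IHH 1) ?group1 ?(subsetP (joing_subr _ _)) //.
    by rewrite xq yq mulg1.
  suff /subsetP sS : G^`(1) \subset Group gS by move=> /sS; rewrite inE => /andP[_ /eqP].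
  rewrite gen_subG; apply/subsetP=> _ /imset2P[x y Gx Gy ->].
  (* The commutator is the product of [x^-1] and [x ^ y], both in <x>G', where the [q]-th power is
     multiplicative. As [x ^+ q] is central, the two powers cancel. *)
  have G'xy : [~ x, y] \in G^`(1) by rewrite mem_commg.
  rewrite inE G'xy /=; apply/eqP.
  have Hx : x \in <[x]> <*> G^`(1) by rewrite (subsetP (joing_subl _ _)) ?cycle_id.
  have Hxy : x ^ y \in <[x]> <*> G^`(1).
    by rewrite -(mulKVg x (x ^ y)) -commgEl groupM // (subsetP (joing_subr _ _)).
  rewrite commgEl (IHH x) ?groupV // expgVn -conjXg.
  by rewrite conjgE (cGq x y) // mulKg mulVg.
have pow_mod x t : x \in G -> t \in G^`(1) -> (x * t) ^+ q = x ^+ q.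
  move=> Gx G't; rewrite (IHH x) //; last 2 first.
  - by rewrite (subsetP (joing_subl _ _)) ?cycle_id.
  - by rewrite (subsetP (joing_subr _ _)).
  by rewrite (powG' t) // mulg1.
have [i i_neq] := exists_expn_neq_mod p_pr (c_gt0 : 1 < c.+1) ltcp.
pose T := Group (power_graph_group_set i (der_normal 1 G) (subxx G) (sub_der1_abelian (subxx _))).
set N := 'L_c.+1(T).
have nNT : T \subset 'N(N) := lcn_norm _ T.
have prodX (u : gT * gT) n : u ^+ n = (u.1 ^+ n, u.2 ^+ n).
  by elim: n => [|n IHn] //; rewrite !expgS IHn.
have sTGG : T \subset setX G G by apply/subsetP=> u; rewrite inE => /andP[].
have pT : p.-group T.
  by rewrite (pgroupS sTGG) // /pgroup cardsX pnatM -/(pgroup p G) pG.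
have powT : {in T / N &, forall u v, (u * v) ^+ q = u ^+ q * v ^+ q}.
  apply: (IHc _ (T / N)%G) (ltnW ltcp) _; rewrite ?quotient_pgroup //.
    apply/lcn_nil_classP; first by rewrite quotient_nil ?(pgroup_nil pT).
    by rewrite -morphim_lcn // [_ @* _]trivg_quotient.
  move=> _ /morphimP[u nNu Tu ->]; rewrite -morphX //=.
  apply: (subsetP (morphim_center T (coset_morphism N))); apply: mem_morphim; first exact: groupX.
  apply/centerP; split=> [|v Tv]; first exact: groupX.
  move: (subsetP sTGG u Tu) (subsetP sTGG v Tv); rewrite !inE prodX.
  move=> /andP[Gu1 Gu2] /andP[Gv1 Gv2]; congr (_, _); exact: cGq.
pose D (x y : gT) := ((x * y) ^+ q)^-1 * (x ^+ q * y ^+ q).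
have powT_mem x : x \in G -> (x, x ^+ i) \in T.
  by move=> Gx; rewrite !inE /= Gx groupX //= morphX ?(subsetP (der_norm 1 G)) //=.
have D_pow : D (g ^+ i) (h ^+ i) = D g h ^+ (i ^ c.+1).
  set u := (g, g ^+ i); set v := (h, h ^+ i).
  have [Tu Tv] : u \in T /\ v \in T by split; apply: powT_mem.
  have [nu nv] : u \in 'N(N) /\ v \in 'N(N) by split; apply: (subsetP nNT).
  have Nw : ((u * v) ^+ q)^-1 * (u ^+ q * v ^+ q) \in N.
    apply: coset_idr; first by rewrite !(groupM, groupV, groupX).
    have := powT _ _ (mem_quotient N Tu) (mem_quotient N Tv).
    rewrite -morphM // -!morphX ?groupM // -morphM ?groupX // => e.
    by rewrite morphM ?morphV ?groupV ?groupM ?groupX ?groupM //= e mulVg.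
  (* Since [G] has class at most [c.+1], the term ['L_c.+2(G)] is trivial and the congruence
     defining the graph is an equality. *)
  have := subsetP (lcn_power_graph c (subxx T)) _ Nw.
  case/(power_graph_dec (lcn_normal _ _) (lcn_sub _ _)) => _ _ [z].
  rewrite /= (lcn_nil_classP _ nilG cG) => /set1P->; rewrite mulg1 !prodX.
  by [].
have nG' : G \subset 'N(G^`(1)) := der_norm 1 G.
(* The elements [(g * h) ^+ i] and [g ^+ i * h ^+ i] agree modulo G', so [pow_mod] gives them the
   same [q]-th power. *)
have D_lin : D (g ^+ i) (h ^+ i) = D g h ^+ i.
  rewrite {1}/D; set t := ((g * h) ^+ i)^-1 * (g ^+ i * h ^+ i).
  have G't : t \in G^`(1).
    have Gt : t \in G by rewrite groupM ?groupV ?groupM ?groupX ?groupM.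
    apply: coset_idr; first exact: (subsetP nG').
    have [ng nh] : g \in 'N(G^`(1)) /\ h \in 'N(G^`(1)) by split; apply: (subsetP nG').
    have ngh : (g * h) ^+ i \in 'N(G^`(1)) by rewrite groupX ?groupM.
    rewrite morphM ?morphV ?groupV //; last by rewrite groupM ?groupX.
    rewrite !morphX ?groupM // !morphM ?groupX // !morphX // expgMn; first exact: mulVg.
    by apply: (centsP (sub_der1_abelian (subxx _))); rewrite mem_quotient.
  have Ggh := groupM Gg Gh.
  rewrite -(mulKVg ((g * h) ^+ i) (g ^+ i * h ^+ i)) -/t pow_mod ?groupX //.
  rewrite /D -!expgM !(mulnC i) !expgM.
  have cgh : commute (g ^+ q) (h ^+ q) by apply: cGq; rewrite ?groupX.
  have cDgh : commute (g ^+ q * h ^+ q) ((g * h) ^- q).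
    by apply/commuteV/commute_sym/cGq; rewrite // groupM ?groupX.
  by rewrite (expgMn _ (commute_sym cDgh)) (expgMn _ cgh) expgVn.
suff: D g h = 1 by move/eqP; rewrite -eq_mulVg1 => /eqP.
apply/eqP/idPn=> ntD; case/negP: i_neq.
have pD : p.-elt (D g h).
  by rewrite (mem_p_elt pG) // !(groupM, groupV, groupX).
have [] := pgroup_pdiv pD (_ : <[D g h]> != 1); first by rewrite cycle_eq1.
move=> _ p_dv_D _.
have: i ^ c.+1 == i %[mod #[D g h]] by rewrite -eq_expg_mod_order -D_pow D_lin.
by move=> /eqP e; rewrite -(modn_dvdm i p_dv_D) -(modn_dvdm (i ^ _) p_dv_D) e.
Qed.

(** * Powers in a [p]-group with a large cyclic subgroup *)

Lemma mem_cycle_pexp (gT : finGroupType) (x y : gT) p a b e :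
    prime p -> #[x] = (p ^ e)%N -> y \in <[x]> -> y ^+ (p ^ a) = 1 ->
    a + b <= e -> y \in <[x ^+ (p ^ b)]>.
Proof.
move=> p_pr ox /cycleP[j ->] yp1 le_ab.
have: p ^ e %| j * p ^ a by rewrite -ox order_dvdn expgM yp1.
move/(dvdn_trans (dvdn_exp2l p le_ab)); rewrite expnD mulnC dvdn_pmul2r ?expn_gt0 ?prime_gt0 //.
by case/dvdnP=> k ->; rewrite mulnC expgM mem_cycle.
Qed.

(** Each element of ['L_j.+1(P)] is [c * y] with [c] in ['L_j.+2(P)] and [y] in ['L_j.+1(P) :&: X],
    hence central. Its commutators are then those of [c] up to conjugacy, so ['L_j.+2(P)] lies in
    ['L_j.+3(P)] and nilpotency kills it. *)
Lemma lcn_eq1_of_sub_join (gT : finGroupType) (P X : {group gT}) j :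
    nilpotent P -> X \subset P -> 'L_j.+1(P) :&: X \subset 'C(P) ->
    'L_j.+1(P) \subset 'L_j.+2(P) <*> X ->
  'L_j.+2(P) = 1.
Proof.
move=> nilP sXP cLX sLCX; set C := 'L_j.+2(P) in sLCX *.
have sCL : C \subset 'L_j.+1(P) := lcn_subS _ _.
have nCP : P \subset 'N(C) := lcn_norm _ _.
have sC : C \subset 'L_j.+3(P).
  rewrite {1}/C lcnSn gen_subG; apply/subsetP=> _ /imset2P[l g Ll Pg ->].
  have := subsetP sLCX l Ll; rewrite norm_joinEr ?(subset_trans sXP) //.
  case/mulsgP=> c y Cc Xy Dl.
  have cy : y \in 'C(P).
    apply: (subsetP cLX); rewrite inE Xy andbT.
    by rewrite -(mulKg c y) -Dl groupM ?groupV // (subsetP sCL).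
  have y1 : [~ y, g] = 1 by apply/eqP/commgP; exact: (centP cy).
  rewrite Dl commMgJ y1 mulg1 memJ_norm ?mem_commg //.
  by apply: (subsetP (lcn_norm j.+3 P)); apply: (subsetP sXP).
apply/eqP/idPn=> ntC.
have := nil_comm_properl nilP (lcn_sub j.+2 P) ntC (_ : P \subset 'N_P(C)).
by rewrite subsetI subxx nCP => /(_ isT); rewrite properE sC andbF.
Qed.

Lemma power_map_structure (gT : finGroupType) (P : {group gT}) x p e f :
    prime p -> f.+1 < p -> #|P| = (p ^ (e + f))%N -> x \in P ->
    #[x] = (p ^ e)%N -> {in P, forall g, g ^+ (p ^ e) = 1} -> 2 * f <= e ->
  [/\ {in P, forall g, g ^+ (p ^ f) \in <[x ^+ (p ^ f)]>},
      x ^+ (p ^ f) \in 'Z(P)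
    & {in P &, forall g h, (g * h) ^+ (p ^ f) = g ^+ (p ^ f) * h ^+ (p ^ f)}].
Proof.
move=> p_pr; elim: f P => [|f IHf] P ltfp oP Px ox eP le_f_e.
  have DP : <[x]> = P.
    by apply/eqP; rewrite eqEcard cycle_subG Px oP addn0 -orderE ox /=.
  have abP : abelian P by rewrite -DP cycle_abelian.
  split=> [g Pg||g h Pg Ph]; rewrite ?expg1 ?DP //.
  by rewrite (center_idP abP).
have [p_gt0 p_gt1] := (prime_gt0 p_pr, prime_gt1 p_pr).
have pP : p.-group P by rewrite /pgroup oP pnatX pnat_id.
have odd_p : odd p by case/even_prime: p_pr ltfp => // ->.
have sXP : <[x]> \subset P by rewrite cycle_subG.
have ltXP : <[x]> \proper P.
  rewrite properEcard sXP oP -orderE ox ltn_exp2l //.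
  by rewrite addnS ltnS leq_addr.
have [M maxM sXM] : exists2 M : {group gT}, maximal M P & <[x]> \subset M.
  have [DP|[M maxM sXM]] := maximal_exists sXP; last by exists M.
  by rewrite DP properxx in ltXP.
have nMP : M <| P := p_maximal_normal pP maxM.
have sMP := normal_sub nMP.
have iMP : #|P : M| = p := p_maximal_index pP maxM.
have oM : #|M| = (p ^ (e + f))%N.
  by apply/eqP; rewrite -(eqn_pmul2r p_gt0) -{1}iMP Lagrange // oP addnS expnSr.
have Mx : x \in M by rewrite -cycle_subG.
have le_f_e' : 2 * f <= e by apply: leq_trans le_f_e; rewrite leq_mul2l leqnSn.
have [Mq zM Mmorph] := IHf M (ltnW ltfp) oM Mx ox (sub_in1 (subsetP sMP) eP) le_f_e'.
set q' := (p ^ f)%N in Mq zM Mmorph.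
have Dq : (p ^ f.+1 = q' * p)%N by rewrite expnSr.
set z := x ^+ q' in Mq zM.
have oz : #[z] = (p ^ (e - f))%N.
  exact: orderXexp ox.
have zp : z ^+ p = x ^+ (p ^ f.+1) by rewrite Dq expgM.
have Mp g : g \in P -> g ^+ p \in M.
  move=> Pg; have nMg : g \in 'N(M) by rewrite (subsetP (normal_norm nMP)).
  apply: coset_idr; first exact: groupX.
  rewrite morphX //; apply/eqP; rewrite -order_dvdn -iMP -card_quotient ?normal_norm //.
  by rewrite order_dvdG ?mem_quotient.
(* As [g ^+ p] is in [M], this power lies in [<[z]>]. The bound on the exponent of [P] makes its
   order smaller than [#[z]], so it lies in [<[z ^+ p]>]. *)
have Pq : {in P, forall g, g ^+ (p ^ f.+1) \in <[x ^+ (p ^ f.+1)]>}.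
  move=> g Pg; rewrite -zp.
  have := @mem_cycle_pexp _ z (g ^+ (p ^ f.+1)) p (e - f.+1) 1 (e - f) p_pr oz.
  rewrite expn1; apply.
  - by rewrite Dq mulnC expgM Mq ?Mp.
  - by rewrite -expgM -expnD subnKC ?eP //; clear -le_f_e; lia.
  by clear -le_f_e; lia.
have zP : x ^+ (p ^ f.+1) \in 'Z(P).
  apply/centerP; split=> [|u Pu]; first exact: groupX.
  (* [u] normalizes [<[z]>] because [z ^ u] is a [q']-th power of an element of [M], and [u ^+ p],
     being in [M], centralizes [z]. *)
  rewrite -zp; apply/commgP/conjg_fixP; apply: conj_pth_power_fix => //.
  - by rewrite /p_elt oz pnatX pnat_id.
  - by rewrite {1}/z conjXg Mq // memJ_norm // (subsetP (normal_norm nMP)).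
  apply/conjg_fixP/commgP; have [_ cz] := centerP _ _ zM; exact/cz/Mp.
have cPq g h : g \in P -> h \in P -> commute (g ^+ (p ^ f.+1)) h.
  move=> Pg Ph; have /cycleP[j ->] := Pq g Pg.
  by apply/commute_sym/commuteX/commute_sym; have [_] := centerP _ _ zP; apply.
split=> //; apply: (expg_morph p_pr pP); last first.
  move=> g Pg; apply/centerP; split=> [|h Ph]; first exact: groupX.
  exact: cPq.
apply: leq_ltn_trans ltfp.
have Mmorph' : {in M &, forall g h, (g * h) ^+ (p ^ f.+1) = g ^+ (p ^ f.+1) * h ^+ (p ^ f.+1)}.
  move=> g h Mg Mh; rewrite Dq !expgM Mmorph // expgMn //.
  have /cycleP[j ->] := Mq g Mg; have /cycleP[k ->] := Mq h Mh.
  exact/commuteX/commute_sym/commuteX.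
have gD : group_set [set m in M | m ^+ (p ^ f.+1) == 1].
  apply/group_setP; split=> [|g h]; first by rewrite inE group1 expg1n /=.
  rewrite !inE => /andP[Mg /eqP g1] /andP[Mh /eqP h1].
  by rewrite groupM //= Mmorph' // g1 h1 mulg1.
pose D := Group gD.
have sDM : D \subset M by apply/subsetP=> g; rewrite inE => /andP[].
have nDP : D <| P.
  rewrite /normal (subset_trans sDM) //; apply/subsetP=> u Pu.
  rewrite inE; apply/subsetP=> _ /imsetP[g Dg ->].
  move: Dg; rewrite !inE -conjXg => /andP[Mg /eqP->].
  by rewrite conj1g eqxx memJ_norm ?Mg // (subsetP (normal_norm nMP)).
(* M/D is central in P/D: the power map is multiplicative on [M] with values central in [P], so it
   kills every commutator of [M] with [P]. As P/M is cyclic, P/D is abelian. *)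
have sP'D : P^`(1) \subset D.
  apply: der1_min; first exact: normal_norm.
  apply: (@cyclic_factor_abelian _ (M / D)%G).
    apply/subsetIP; split; first exact: quotientS.
    rewrite quotient_cents2 ?(subset_trans sMP) ?normal_norm //.
    rewrite gen_subG; apply/subsetP=> _ /imset2P[m u Mm Pu ->].
    have Mmu : m ^ u \in M by rewrite memJ_norm // (subsetP (normal_norm nMP)).
    rewrite inE commgEl groupM ?groupV //= Mmorph' ?groupV // expgVn -conjXg.
    by rewrite conjgE (cPq m u) ?mulKg ?mulVg // (subsetP sMP).
  rewrite (isog_cyclic (third_isog sDM nDP nMP)) prime_cyclic //.
  by rewrite card_quotient ?normal_norm // iMP.
have nilP := pgroup_nil pP.
apply/lcn_nil_classP=> //; apply/eqP/idPn=> ntL.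
have le_ff : f.+1 + f.+1 <= e by rewrite addnn -mul2n.
(* Such elements lie in [D], so [p ^ f.+1] kills them; twice [f.+1] being at most [e], they are
   powers of the central element [x ^+ (p ^ f.+1)]. *)
have cLX j : 'L_j.+2(P) :&: <[x]> \subset 'C(P).
  apply/subsetP=> y /setIP[Ly Xy].
  have : y \in D.
    by apply: (subsetP sP'D); apply: subsetP Ly; rewrite -lcn2; apply: lcn_sub_leq.
  rewrite inE => /andP[_ /eqP yq].
  have /cycleP[k ->] := mem_cycle_pexp p_pr ox Xy yq le_ff.
  by rewrite groupX //; have /setIP[] := zP.
(* The subgroups L_j(P)<x>, j >= 2, lie in M and strictly decrease as long as
   L_(j+1)(P) is nontrivial, and P has index p ^ f.+1 over <x>. *)
have chain j : 'L_j.+2(P) != 1 -> #|'L_j.+2(P) <*> <[x]>| * p ^ j <= p ^ (e + f).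
  elim: j => [|j IHj] ntLj.
    by rewrite muln1 -oM subset_leq_card // join_subG sXM lcn2 (subset_trans sP'D).
  have ntLj1: 'L_j.+2(P) != 1.
    apply: contraNneq ntLj => L1.
    by have := lcn_subS j.+2 P; rewrite L1 => s1; apply/eqP/trivgP.
  apply: leq_trans (IHj ntLj1); rewrite expnS mulnA leq_mul2r; apply/orP; right.
  have sKK : 'L_j.+3(P) <*> <[x]> \subset 'L_j.+2(P) <*> <[x]>.
    by rewrite genS // setSU // lcn_subS.
  rewrite -(Lagrange sKK) leq_mul2l; apply/orP; right.
  have pK : p.-group ('L_j.+2(P) <*> <[x]>).
    by apply: pgroupS pP; rewrite join_subG lcn_sub.
  have [sKK' | ] := boolP ('L_j.+2(P) <*> <[x]> \subset 'L_j.+3(P) <*> <[x]>).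
    case/eqP: ntLj; apply: lcn_eq1_of_sub_join sXP _ _ => //.
    exact: subset_trans (joing_subl _ _) sKK'.
  rewrite -indexg_gt1.
  have /p_natP[[|k] ->] := pnat_dvd (dvdn_indexg _ ('L_j.+3(P) <*> <[x]>)) pK => //.
  by rewrite -{2}(expn1 p) leq_exp2l.
(* With [j] equal to [f.+1] the bound would force a subgroup containing [x] to have order below
   [p ^ e]. *)
have := chain f.+1 ntL; rewrite leqNgt => /negP[].
have: p ^ e <= #|'L_f.+3(P) <*> <[x]>| by rewrite -ox subset_leq_card ?joing_subr.
rewrite -(leq_pmul2r (_ : 0 < p ^ f.+1)) ?expn_gt0 ?p_gt0 //; apply: leq_trans.
by rewrite -expnD ltn_exp2l // addnS.
Qed.

(** * Adjoining a central root *)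

(** The last clause, with [c ^+ r = iota w], says that [c] has order exactly [r] modulo the image of
    [P]. *)
Lemma adjoin_central_root (gT : finGroupType) (P : {group gT}) w r :
    w \in 'Z(P) -> 0 < r ->
  exists (rT : finGroupType) (iota : gT -> rT) (c : rT),
  [/\ {in P &, {morph iota : g h / g * h}}, {in P &, injective iota},
      {in P, forall g, commute c (iota g)}, c ^+ r = iota w
    & forall j g, g \in P -> c ^+ j = iota g -> r %| j].
Proof.
(* The cyclic factor ['I_s.+1] gets order [r * #[w]], so that [c0 ^+ r] has the order of [w] and the
   quotient below stays injective on [P]. *)
move=> /setIP[Pw cPw] r_gt0; pose s := (r * #[w]).-1.
have Ds : s.+1 = (r * #[w])%N by rewrite prednK // muln_gt0 r_gt0 order_gt0.
pose c0 : 'I_s.+1 := Zp1; have oc0 : #[c0] = (r * #[w])%N by rewrite order_Zp1.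
pose a : gT * 'I_s.+1 := (w^-1, c0 ^+ r); pose N := <[a]>%G.
(* The required group is the central product (P x <c0>) / <(w^-1, c0 ^ r)>. *)
have prodX (u : gT * 'I_s.+1) n : u ^+ n = (u.1 ^+ n, u.2 ^+ n).
  by elim: n => [|n IHn] //; rewrite !expgS IHn.
have prodV (g : gT) (u : 'I_s.+1) : (g, u)^-1 = (g^-1, u^-1) by [].
have prodM (g h : gT) (u v : 'I_s.+1) : (g, u) * (h, v) = (g * h, u * v) by [].
have Zp_comm (u v : 'I_s.+1) : commute u v.
  by apply: (centsP (Zp_abelian s)); rewrite inE.
have nN g (u : 'I_s.+1) : g \in P -> (g, u) \in 'N(N).
  move=> Pg; apply: (subsetP (cent_sub _)); rewrite cent_cycle; apply/cent1P.
  rewrite /commute /a; congr (_, _); last exact: Zp_comm.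
  exact: (commuteV (commute_sym (centP cPw _ Pg))).
pose iota g := coset N (g, 1).
have iotaM : {in P &, {morph iota : g h / g * h}}.
  by move=> g h Pg Ph; rewrite /iota -coset_morphM ?nN // prodM mulg1.
have dvd_r k j : c0 ^+ j = c0 ^+ (r * k) -> r %| j.
  move/eqP; rewrite eq_expg_mod_order oc0 => /eqP e.
  by rewrite /dvdn -(modn_dvdm j (dvdn_mulr #[w] (dvdnn r))) e modn_dvdm ?dvdn_mulr // modnMr.
exists (coset_of N), iota, (coset N (1, c0)); split=> //.
- move=> g h Pg Ph e.
  have: (g^-1 * h, 1) \in N.
    have -> : (g^-1 * h, 1) = (g, 1)^-1 * (h, 1 : 'I_s.+1) by rewrite prodV prodM invg1 mulg1.
    apply: coset_idr; first by rewrite groupM ?groupV ?nN.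
    by rewrite coset_morphM ?groupV ?nN // -/(iota h) -e /iota -coset_morphM ?groupV ?nN // mulVg morph1.
  case/cycleP=> k; rewrite prodX /= => -[gh /esym/eqP].
  rewrite -expgM -order_dvdn oc0 dvdn_pmul2l // order_dvdn => /eqP wk.
  by move: gh; rewrite expgVn wk invg1 => /eqP; rewrite -eq_mulVg1 => /eqP.
- move=> g Pg; rewrite /iota /commute -!coset_morphM ?nN //.
  by rewrite !prodM !mulg1 !mul1g.
- have nN1 := nN 1 c0 (group1 P).
  rewrite /iota -morphX //= -(mulg1 (coset N (w, 1))).
  have <- : coset N a = 1 by rewrite coset_id ?cycle_id.
  rewrite -coset_morphM; last 2 first.
  + exact: nN.
  + by rewrite nN ?groupV.
  by rewrite prodX /a prodM /= expg1n mulgV mul1g.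
move=> j g Pg e.
have: (g^-1, c0 ^+ j) \in N.
  have -> : (g^-1, c0 ^+ j) = (g, 1)^-1 * (1, c0) ^+ j.
    by rewrite prodX prodV prodM /= expg1n mulg1 invg1 mul1g.
  have nN1 := nN 1 c0 (group1 P).
  apply: coset_idr; first by rewrite groupM ?groupV ?groupX ?nN.
  rewrite coset_morphM ?groupV ?groupX ?nN // morphX //= e /iota.
  by rewrite -coset_morphM ?groupV ?nN // mulVg morph1.
case/cycleP=> k; rewrite prodX /= => -[_]; rewrite -expgM; exact: dvd_r.
Qed.

(** * Groups of coexponent [f] as a kernel extended by a cyclic group *)

Definition coexp_group (gT : finGroupType) p f m (P : {group gT}) x : Prop :=
  [/\ #|P| = (p ^ (m + 2 * f))%N, exponent P = (p ^ (m + f))%N, x \in P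
    & #[x] = (p ^ (m + f))%N].

Lemma coexp_group_pow (gT : finGroupType) p f m (P : {group gT}) x :
    prime p -> f.+1 < p -> f <= m -> coexp_group p f m P x ->
  [/\ {in P, forall g, g ^+ (p ^ f) \in <[x ^+ (p ^ f)]>},
      forall k, f <= k -> x ^+ (p ^ k) \in 'Z(P)
    & {in P &, forall g h, (g * h) ^+ (p ^ f) = g ^+ (p ^ f) * h ^+ (p ^ f)}].
Proof.
move=> p_pr ltfp le_fm [oP eP Px ox].
have oP' : #|P| = (p ^ (m + f + f))%N by rewrite oP mul2n -addnn addnA.
have gP : {in P, forall g, g ^+ (p ^ (m + f)) = 1}.
  by apply/exponentP; rewrite eP.
have [Pq xZ powM] := power_map_structure p_pr ltfp oP' Px ox gP (ltac:(lia)).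
split=> // k le_fk; rewrite -(subnKC le_fk) expnD expgM.
exact: groupX.
Qed.

Lemma coexp_group_Ldiv (gT : finGroupType) p f m (P : {group gT}) x :
    prime p -> f.+1 < p -> f <= m -> coexp_group p f m P x ->
  exists K : {group gT}, [/\ K :=: 'Ldiv_(p ^ f)(P), P \subset 'N(K),
    (K * <[x]>)%g = P, #|K| = (p ^ (2 * f))%N & K :&: <[x]> = <[x ^+ (p ^ m)]>].
Proof.
move=> p_pr ltfp le_fm cP; have [Pq xZ powM] := coexp_group_pow p_pr ltfp le_fm cP.
have [oP eP Px ox] := cP; set q := (p ^ f)%N in Pq powM *.
have gK : group_set 'Ldiv_q(P).
  apply/group_setP; split=> [|g h]; first by apply/LdivP; rewrite expg1n group1.
  case/LdivP=> Pg g1 /LdivP[Ph h1]; apply/LdivP.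
  by rewrite groupM // powM // g1 h1 mulg1.
exists (Group gK); rewrite /=.
have sXP : <[x]> \subset P by rewrite cycle_subG.
have nKP : P \subset 'N('Ldiv_q(P)).
  apply/subsetP=> u Pu; rewrite inE; apply/subsetP=> _ /imsetP[g /LdivP[Pg g1] ->].
  by apply/LdivP; rewrite -conjXg g1 conj1g groupJ.
have DKX : 'Ldiv_q(P) * <[x]> = P.
  apply/eqP; rewrite eqEsubset mul_subG ?subsetIl //=; apply/subsetP=> g Pg.
  have /cycleP[j gq] := Pq g Pg.
  (* Since [g] and [x ^+ j] have the same [q]-th power, their quotient is in the kernel. *)
  rewrite -(mulgKV (x ^+ j) g) mem_mulg ?mem_cycle //; apply/LdivP.
  rewrite groupM ?groupV ?groupX // powM ?groupV ?groupX //; split=> //.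
  by rewrite gq expgVn -!expgM mulnC mulgV.
have KX : 'Ldiv_q(P) :&: <[x]> = <[x ^+ (p ^ m)]>.
  apply/eqP; rewrite eqEsubset; apply/andP; split.
    apply/subsetP=> y /setIP[/LdivP[_ y1] Xy].
    by apply: mem_cycle_pexp p_pr ox Xy y1 _; rewrite addnC.
  rewrite -['Ldiv_q(P) :&: _]/(gval (Group gK :&: <[x]>)%G) cycle_subG inE mem_cycle andbT /=; apply/LdivP; split; first exact: groupX.
  by rewrite -expgM -expnD -ox expg_order.
split=> //; apply/eqP; have p_gt0 := prime_gt0 p_pr.
rewrite -(eqn_pmul2r (_ : 0 < #[x])) ?order_gt0 //.
have := mul_cardG (Group gK) <[x]>%G; rewrite /= DKX KX -!orderE => ->.
by rewrite oP (orderXexp _ ox) addKn ox -!expnD; apply/eqP; congr (p ^ _)%N; ring.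
Qed.

(** An isomorphism between the kernels of the two power maps, compatible with the actions of [x] and
    [y] and with the elements along which the cyclic parts are glued. As [m] and [m'] may differ,
    [P] and [Q] may have different orders. *)
Definition matching (gT rT : finGroupType) p f m m' (P : {set gT}) (Q : {set rT})
    (phi : gT -> rT) x y : Prop :=
  [/\ {in 'Ldiv_(p ^ f)(P) &, {morph phi : g h / g * h}},
      {in 'Ldiv_(p ^ f)(P) &, injective phi},
      phi @: 'Ldiv_(p ^ f)(P) = 'Ldiv_(p ^ f)(Q),
      {in 'Ldiv_(p ^ f)(P), forall k, phi (k ^ x) = phi k ^ y}
    & phi (x ^+ (p ^ m)) = y ^+ (p ^ m')].

(** The composite of [phi] with the inverse of [phi'] on the kernels, and [x] sent to [x'], agree on
    [<[x ^+ (p ^ m)]>] and respect the action, so they glue to a morphism on [P]. *)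
Lemma matching_isog (gT rT hT : finGroupType) p f m m' (P : {group gT})
    (P' : {group hT}) (Q : {group rT}) phi phi' x x' y :
    prime p -> f.+1 < p -> f <= m ->
    coexp_group p f m P x -> coexp_group p f m P' x' ->
    matching p f m m' P Q phi x y -> matching p f m m' P' Q phi' x' y ->
  P \isog P'.
Proof.
move=> p_pr ltfp le_fm cP cP' [phiM phiI phiK phiJ phix] [phiM' phiI' phiK' phiJ' phix'].
have [K [DK nKP KX oK KIX]] := coexp_group_Ldiv p_pr ltfp le_fm cP.
have [K' [DK' nKP' KX' oK' KIX']] := coexp_group_Ldiv p_pr ltfp le_fm cP'.
have [oP _ Px ox] := cP; have [oP' _ Px' ox'] := cP'.
rewrite -DK in phiM phiI phiK phiJ; rewrite -DK' in phiM' phiI' phiK' phiJ'.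
have nKx : x \in 'N(K) by apply: (subsetP nKP).
have nKx' : x' \in 'N(K') by apply: (subsetP nKP').
have Kxm : x ^+ (p ^ m) \in K.
  by have: x ^+ (p ^ m) \in K :&: <[x]> by [rewrite KIX cycle_id]; case/setIP.
have Kxm' : x' ^+ (p ^ m) \in K'.
  by have: x' ^+ (p ^ m) \in K' :&: <[x']> by [rewrite KIX' cycle_id]; case/setIP.
(* The default 1 is never taken on [K], because [phi] and [phi'] have the same image. *)
pose theta k := odflt 1 [pick k' in K' | phi' k' == phi k].
have thetaP k : k \in K -> theta k \in K' /\ phi' (theta k) = phi k.
  move=> Kk; rewrite /theta; case: pickP => [k' /andP[Kk' /eqP] //|/= no].
  have: phi k \in phi' @: K' by rewrite phiK' -phiK imset_f.
  by case/imsetP=> k' Kk' e; have := no k'; rewrite Kk' e eqxx.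
have theta_uniq k k' : k \in K -> k' \in K' -> phi' k' = phi k -> theta k = k'.
  by move=> Kk Kk' e; have [Kt et] := thetaP k Kk; apply: phiI' => //; rewrite et.
have thetaM : {in K &, {morph theta : g h / g * h}}.
  move=> g h Kg Kh; have [[tg eg] [th eh]] := (thetaP g Kg, thetaP h Kh).
  by apply: theta_uniq; rewrite ?groupM // phiM' // phiM // eg eh.
have thetaX k i : k \in K -> theta (k ^ (x ^+ i)) = theta k ^ (x' ^+ i).
  move=> Kk; elim: i => [|i IHi]; first by rewrite !conjg1.
  have Kki : k ^ (x ^+ i) \in K by rewrite memJ_norm // groupX.
  have [tk ek] := thetaP _ Kki.
  rewrite !expgSr !conjgM -IHi; apply: theta_uniq; rewrite ?memJ_norm ?groupX //.
  by rewrite phiJ' // phiJ // ek.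
have theta_xm : theta (x ^+ (p ^ m)) = x' ^+ (p ^ m).
  by apply: theta_uniq; rewrite // phix phix'.
have dvd_x : #[x'] %| #[x] by rewrite ox ox'.
pose ft := Morphism thetaM.
have nKX : <[x]> \subset 'N(K) by rewrite cycle_subG.
have actf : {in K & <[x]>, morph_act 'J 'J ft (eltm dvd_x)}.
  by move=> k _ Kk /cycleP[i ->] /=; rewrite eltmE thetaX.
have eqf : {in K :&: <[x]>, ft =1 eltm dvd_x}.
  move=> g; rewrite KIX => /cycleP[i ->].
  rewrite (morphX ft) //= theta_xm -!expgM eltmE //.
have DP : K <*> <[x]> = P by rewrite norm_joinEr.
pose F := pprodm_morphism nKX actf eqf.
(* Surjectivity suffices: the equal orders of [P] and [P'] then give injectivity. *)
have imF : F @* P = P'.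
  rewrite -KX [F @* _]morphim_pprodm // -KX'; congr (_ * _).
    apply/eqP; rewrite eqEcard; apply/andP; split.
      by apply/subsetP=> _ /morphimP[k _ Kk ->]; case: (thetaP k Kk).
    rewrite oK' -oK card_injm //; apply/injmP=> g h Kg Kh /= e.
    by apply: phiI => //; rewrite -(thetaP g Kg).2 -(thetaP h Kh).2 e.
  by rewrite morphim_cycle ?cycle_id //= eltm_id.
have sPD : P \subset K <*> <[x]> by rewrite DP.
rewrite -imF; apply: sub_isog => //.
rewrite -card_im_injm; have -> : F @* (K <*> <[x]>) = P' by rewrite -imF -DP.
by rewrite /= DP oP oP'.
Qed.

(** Two matchings with the same [Q] may use different elements of maximal order. Writing
    [y2 = l * y ^+ j] with [l] in the kernel, the element to take is [x2 = k * x ^+ j] with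
    [phi k = l]. *)
Lemma matching_change_right (gT rT : finGroupType) p f m m' (P : {group gT})
    (Q : {group rT}) phi x y y2 :
    prime p -> 0 < f -> f.+1 < p -> f <= m -> f <= m' ->
    coexp_group p f m P x -> coexp_group p f m' Q y -> coexp_group p f m' Q y2 ->
    matching p f m m' P Q phi x y ->
  exists2 x2, coexp_group p f m P x2 & matching p f m m' P Q phi x2 y2.
Proof.
move=> p_pr f_gt0 ltfp le_fm le_fm' cP cQ cQ2 [phiM phiI phiK phiJ phix].
have [K [DK nKP KX oK KIX]] := coexp_group_Ldiv p_pr ltfp le_fm cP.
have [L [DL nLQ LY oL LIY]] := coexp_group_Ldiv p_pr ltfp le_fm' cQ.
have [_ _ powM] := coexp_group_pow p_pr ltfp le_fm cP.
have [_ _ powMQ] := coexp_group_pow p_pr ltfp le_fm' cQ.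
have [[oP eP Px ox] [_ _ Qy2 oy2]] := (cP, cQ2); have [_ _ Qy _] := cQ.
rewrite -DK in phiM phiI phiK phiJ; rewrite -DL in phiK.
have nKx : x \in 'N(K) by apply: (subsetP nKP).
have Kxm : x ^+ (p ^ m) \in K.
  by have: x ^+ (p ^ m) \in K :&: <[x]> by [rewrite KIX cycle_id]; case/setIP.
pose F := Morphism phiM; have injF : 'injm F by apply/injmP.
have: y2 \in L * <[y]> by rewrite LY.
case/mulsgP=> l _ Ll /cycleP[j ->] Dy2.
have [k Kk Dl] : exists2 k, k \in K & l = phi k by apply/imsetP; rewrite phiK.
have Pk : k \in P by move: Kk; rewrite DK => /LdivP[].
have kq : k ^+ (p ^ f) = 1 by move: Kk; rewrite DK => /LdivP[].
have lq : l ^+ (p ^ f) = 1 by move: Ll; rewrite DL => /LdivP[].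
have Ql : l \in Q by move: Ll; rewrite DL => /LdivP[].
pose x2 := k * x ^+ j.
have Px2 : x2 \in P by rewrite groupM ?groupX.
(* The factor [k] drops out because its order divides [p ^ f] and [f <= m]. *)
have x2m : x2 ^+ (p ^ m) = (x ^+ (p ^ m)) ^+ j.
  rewrite -(subnKC le_fm) expnD !expgM powM ?groupX // kq mul1g.
  by rewrite -!expgM; congr (_ ^+ _); ring.
have y2m : y2 ^+ (p ^ m') = (y ^+ (p ^ m')) ^+ j.
  rewrite Dy2 -(subnKC le_fm') expnD !expgM powMQ ?groupX // lq mul1g.
  by rewrite -!expgM; congr (_ ^+ _); ring.
have phix2 : phi (x2 ^+ (p ^ m)) = y2 ^+ (p ^ m').
  by rewrite x2m y2m -phix; apply: (morphX F).
have phiJX a i : a \in K -> phi (a ^ (x ^+ i)) = phi a ^ (y ^+ i).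
  move=> Ka; elim: i => [|i IHi]; first by rewrite !conjg1.
  by rewrite !expgSr !conjgM -IHi phiJ // memJ_norm ?groupX.
exists x2; last first.
  split; rewrite -?DK -?DL // => a Ka.
  rewrite conjgM phiJX ?groupJ // Dy2 conjgM Dl; congr (_ ^ _).
  exact: (morphJ F).
have ox2m : #[x2 ^+ (p ^ m)] = (p ^ f)%N.
  have Kx2m : x2 ^+ (p ^ m) \in K by rewrite x2m groupX.
  by rewrite -(order_injm injF Kx2m) /= phix2 (orderXexp _ oy2) addKn.
split=> //; rewrite (orderXpfactor ox2m) ?expnD //.
by rewrite -{1}(expn1 p) dvdn_exp2l.
Qed.

(** With [y = iota x * c], the factor [c] leaves the action on the image of [K] unchanged and
    corrects [y ^+ (p ^ m')] to [iota (x ^+ (p ^ m))]. The inequalities [f <= m] and [f <= m'] make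
    [w] central. *)
Lemma matching_exists (gT : finGroupType) p f m m' (P : {group gT}) x :
    prime p -> 0 < f -> f.+1 < p -> f <= m -> f <= m' ->
    coexp_group p f m P x ->
  exists (rT : finGroupType) (Q : {group rT}) phi y,
    coexp_group p f m' Q y /\ matching p f m m' P Q phi x y.
Proof.
move=> p_pr f_gt0 ltfp le_fm le_fm' cP.
have [K [DK nKP KX oK KIX]] := coexp_group_Ldiv p_pr ltfp le_fm cP.
have [Pq xZ powM] := coexp_group_pow p_pr ltfp le_fm cP.
have [oP eP Px ox] := cP; have p_gt0 := prime_gt0 p_pr.
have sKP : K \subset P by rewrite DK subsetIl.
have PK := subsetP sKP.
pose w := x ^+ (p ^ m) * (x ^+ (p ^ m'))^-1.
have Zw : w \in 'Z(P) by rewrite groupM ?groupV ?xZ.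
have r_gt0 : 0 < p ^ m' by rewrite expn_gt0 p_gt0.
have [rT [iota [c [iM iI ci cr cdvd]]]] := adjoin_central_root Zw r_gt0.
pose F := Morphism iM; have injF : 'injm F by apply/injmP.
have iX g j : g \in P -> iota (g ^+ j) = iota g ^+ j.
  by move=> Pg; apply: (morphX F).
have iV g : g \in P -> iota g^-1 = (iota g)^-1.
  by move=> Pg; apply: (morphV F).
have iJg g h : g \in P -> h \in P -> iota (g ^ h) = iota g ^ iota h.
  by move=> Pg Ph; apply: (morphJ F).
pose y := iota x * c.
have yX j : y ^+ j = iota (x ^+ j) * c ^+ j.
  by rewrite iX // expgMn //; apply/commute_sym/ci.
have ym : y ^+ (p ^ m') = iota (x ^+ (p ^ m)).
  have [Pw _] := setIP Zw.
  rewrite yX cr -iM ?groupX //; congr (iota _).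
  by rewrite /w; case/centerP: (xZ m' le_fm') => _ cx; rewrite mulgA cx ?groupX // mulgK.
pose L := (F @* K)%G.
have iJ k j : k \in K -> iota k ^ (y ^+ j) = iota (k ^ (x ^+ j)).
  move=> Kk; have PKk := PK k Kk; rewrite yX conjgM -iJg ?groupX //.
  apply/conjg_fixP/commgP; apply: commuteX; apply: commute_sym; apply: ci.
  by rewrite groupJ ?groupX.
have nLy : y \in 'N(L).
  rewrite inE; apply/subsetP=> _ /imsetP[_ /morphimP[k _ Kk ->] ->] /=.
  have Kkx : k ^ x \in K by rewrite memJ_norm // (subsetP nKP).
  by rewrite -(expg1 y) iJ // expg1; apply: (mem_morphim F) => //; apply: PK.
have nLY : <[y]> \subset 'N(L) by rewrite cycle_subG.
pose Q := (L <*> <[y]>)%G.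
have DQ : Q :=: L * <[y]> by rewrite /= norm_joinEr.
have Kxm : x ^+ (p ^ m) \in K.
  by have: x ^+ (p ^ m) \in K :&: <[x]> by [rewrite KIX cycle_id]; case/setIP.
have Lym : y ^+ (p ^ m') \in L by rewrite ym; apply: (mem_morphim F) => //; apply: groupX.
have oym : #[y ^+ (p ^ m')] = (p ^ f)%N.
  by rewrite ym [#[_]](order_injm injF) ?groupX // (orderXexp _ ox) addKn.
have oy : #[y] = (p ^ (m' + f))%N.
  rewrite (orderXpfactor oym) ?expnD //.
  by rewrite -{1}(expn1 p) dvdn_exp2l.
(* If [y ^+ j] is in [L], then [c ^+ j] is in the image of [P], so [p ^ m'] divides [j]. *)
have LIY : L :&: <[y]> = <[y ^+ (p ^ m')]>.
  apply/eqP; rewrite eqEsubset cycle_subG inE Lym mem_cycle !andbT.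
  apply/subsetP=> g /setIP[/morphimP[k Pk Kk Dk] /cycleP[j Dj]].
  have /dvdnP[i Di] : p ^ m' %| j.
    apply: (cdvd j ((x ^+ j)^-1 * k)); first by rewrite groupM ?groupV ?groupX.
    by rewrite iM ?groupV ?groupX // iV ?groupX // -[iota k]/(F k) -Dk Dj yX mulKg.
  by rewrite Dj Di mulnC expgM mem_cycle.
have oL : #|L| = (p ^ (2 * f))%N by rewrite card_injm.
have oQ : #|Q| = (p ^ (m' + 2 * f))%N.
  apply/eqP; rewrite -(eqn_pmul2r (_ : 0 < p ^ f)) ?expn_gt0 ?p_gt0 //.
  have := mul_cardG L <[y]>%G; rewrite /= -DQ LIY -!orderE oym oL oy => <-.
  by rewrite -!expnD; apply/eqP; congr (p ^ _)%N; ring.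
have Lq l : l \in L -> l ^+ (p ^ f) = 1.
  case/morphimP=> k Pk Kk ->; rewrite -morphX //=.
  by move: Kk; rewrite DK => /LdivP[_ ->]; exact: (morph1 F).
have expQ g : g \in Q -> g ^+ (p ^ (m' + f)) = 1.
  rewrite DQ => /mulsgP[l _ Ll /cycleP[j ->] ->].
  rewrite expnD expgM Lq //; have nLl := subsetP (normG L) l Ll.
  apply: coset_idr; first by rewrite groupX ?groupM ?groupX.
  rewrite morphX ?groupM ?groupX // morphM ?groupX //= coset_id // mul1g.
  by rewrite -morphX ?groupX //= -expgM mulnC expgM coset_id // groupX.
have Qy : y \in Q by rewrite (subsetP (joing_subr _ _)) ?cycle_id.
have eQ : exponent Q = (p ^ (m' + f))%N.
  apply/eqP; rewrite eqn_dvd -{2}oy dvdn_exponent // andbT.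
  exact/exponentP/expQ.
have cQ : coexp_group p f m' Q y by [].
have [K' [DK' _ _ oK' _]] := coexp_group_Ldiv p_pr ltfp le_fm' cQ.
(* The inclusion from left to right is an equality, since both sides have order [p ^ (2 * f)]. *)
have DL : L :=: 'Ldiv_(p ^ f)(Q).
  apply/eqP; rewrite -DK' eqEcard oK' oL leqnn andbT DK'.
  apply/subsetP=> l Ll; apply/LdivP; split; last exact: Lq.
  by rewrite (subsetP (joing_subl _ _)).
exists rT, Q, iota, y; split=> //; split; rewrite -?DK -?DL //.
- by move=> g h /PK Pg /PK Ph; rewrite iM.
- by move=> g h /PK Pg /PK Ph; exact: (iI g h Pg Ph).
- by rewrite /L /= morphimEsub.
by move=> k Kk; rewrite -(expg1 y) iJ // expg1.
Qed.

Lemma matching_isogr (gT rT hT : finGroupType) p f m m' (P : {group gT})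
    (Q : {group rT}) (Q' : {group hT}) phi x y :
    Q \isog Q' -> y \in Q -> matching p f m m' P Q phi x y ->
  exists phi' y', [/\ y' \in Q', #[y'] = #[y] & matching p f m m' P Q' phi' x y'].
Proof.
case/isogP=> psi injpsi <- Qy [phiM phiI phiK phiJ phix].
have QL k : k \in 'Ldiv_(p ^ f)(P) -> phi k \in Q.
  move=> Kk; have: phi k \in phi @: 'Ldiv_(p ^ f)(P) by apply: imset_f.
  by rewrite phiK => /LdivP[].
exists (psi \o phi), (psi y).
split; [exact: mem_morphim | exact: order_injm | split].
- by move=> g h Kg Kh; rewrite /= phiM // morphM ?QL.
- move=> g h Kg Kh /= e; apply: phiI => //.
  by apply: (injmP injpsi) => //; apply: QL.
- rewrite imset_comp phiK; apply/setP=> u; apply/imsetP/LdivP.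
    case=> v /LdivP[Qv v1] ->; split; first exact: mem_morphim.
    by rewrite -morphX // v1 morph1.
  case=> /morphimP[v _ Qv ->] e; exists v => //; apply/LdivP; split=> //.
  by apply: (injmP injpsi); rewrite ?groupX // morph1 morphX.
- by move=> k Kk /=; rewrite phiJ // morphJ ?QL.
by rewrite /= phix morphX.
Qed.

(** * Counting isomorphism classes *)

Lemma coexp_group_witness (gT : finGroupType) p f m (P : {group gT}) :
    prime p -> #|P| = (p ^ (m + 2 * f))%N -> coexponent p P = f ->
  exists x, coexp_group p f m P x.
Proof.
move=> p_pr oP cP; have pP : p.-group P by rewrite /pgroup oP pnatX pnat_id.
have [x Px eP] := exponent_witness (pgroup_nil pP).
have /p_natP[e De] : p.-nat (exponent P) by rewrite pnat_exponent.
have [le_e] := coexponentE p_pr oP De; rewrite cP => Df.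
have Dme : e = (m + f)%N by clear -le_e Df; lia.
by exists x; split; rewrite // -?eP De Dme.
Qed.

Lemma coexp_group_coexponent (gT : finGroupType) p f m (P : {group gT}) x :
  prime p -> coexp_group p f m P x -> coexponent p P = f.
Proof.
move=> p_pr [oP eP _ _]; have [_ ->] := coexponentE p_pr oP eP.
by rewrite mul2n -addnn addnA addKn.
Qed.

(** Each representative for [m] is matched with some representative for [m']. The choice is
    injective: if two share [Q], their matchings can be moved to a common [y], which makes them
    isomorphic. Exchanging [m] and [m'] gives the reverse inequality. *)
Lemma Psi_le p f m m' :
    prime p -> 0 < f -> f.+1 < p -> f <= m -> f <= m' ->
  Psi p (m + 2 * f) f <= Psi p (m' + 2 * f) f.
Proof.
move=> p_pr f_gt0 ltfp le_fm le_fm'.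
have [R [RP Rinj _]] := Psi_spec p (m + 2 * f) f.
have [R' [R'P _ R'all]] := Psi_spec p (m' + 2 * f) f.
have /fin_all_exists[j jP] i : exists j, exists phi x y,
    [/\ coexp_group p f m (R i) x, coexp_group p f m' (R' j) y
      & matching p f m m' (R i) (R' j) phi x y].
  have [oP cP] := RP i; have [x xP] := coexp_group_witness p_pr oP cP.
  have [rT [Q [phi [y [yQ PQ]]]]] := matching_exists p_pr f_gt0 ltfp le_fm le_fm' xP.
  have cQ := coexp_group_coexponent p_pr yQ; have [oQ eQ Qy oy] := yQ.
  have [j QR'] := R'all _ Q oQ cQ.
  have [phi' [y' [R'y' oy' PR']]] := matching_isogr QR' Qy PQ.
  exists j, phi', x, y'; split=> //; split=> //; last by rewrite oy'.
    by rewrite -(card_isog QR').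
  by rewrite -(exponent_isog QR').
rewrite -[X in X <= _]card_ord -[X in _ <= X]card_ord; apply: (leq_card j) => i1 i2 e12.
have [phi1 [x1 [y1 [P1 Q1 M1]]]] := jP i1.
have [phi2 [x2 [y2 [P2 Q2 M2]]]] := jP i2.
rewrite -e12 in Q2 M2.
have [x3 P3 M3] := matching_change_right p_pr f_gt0 ltfp le_fm le_fm' P2 Q2 Q1 M2.
exact: Rinj (matching_isog p_pr ltfp le_fm P1 P3 M1 M3).
Qed.

Theorem theorem2 (f : nat) (hf : 3 <= f) (p : nat) (hp : prime p)
    (hpf : f + 1 < p) (n n' : nat) (hn : 3 * f <= n) (hn' : 3 * f <= n') :
  Psi p n f = Psi p n' f.
Proof.
have split_n k : 3 * f <= k -> exists2 m, f <= m & k = (m + 2 * f)%N.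
  by move=> le_fk; exists (k - 2 * f); clear -le_fk; lia.
have f_gt0 : 0 < f := ltn_trans (isT : 0 < 2) hf.
have ltfp : f.+1 < p by rewrite -addn1.
have [m le_fm ->] := split_n n hn; have [m' le_fm' ->] := split_n n' hn'.
by apply/eqP; rewrite eqn_leq !Psi_le.
Qed.
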